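(* Let $G$ be a gap sequence of genus $g$, $\lambda=(\lambda_1,\dots,\lambda_g)$ its associated partition, and $0\le k\le g$. (i) $\partial_{a^{(k)}_1}\cdots\partial_{a^{(k)}_{m_k}}s_\lambda\big(\sum_{i=1}^k[x_i]\big)=c_k\,s_{(\lambda_1,\dots,\lambda_k)}\big(\sum_{i=1}^k[x_i]\big)$. (ii) If $\mu=(\mu_1,\dots,\mu_g)$ is a partition with $\mu_i=\lambda_i$ for $k+1\le i\le g$, then $\partial_{a^{(k)}_1}\cdots\partial_{a^{(k)}_{m_k}}s_\mu\big(\sum_{i=1}^k[x_i]\big)=c_k\,s_{(\mu_1,\dots,\mu_k)}\big(\sum_{i=1}^k[x_i]\big)$ with the same $c_k$.
   Context: For $t=(t_1,t_2,\dots)$ define polynomials $p_m(t)$ by $\exp(\sum_{m\ge1}t_mk^m)=\sum_{m\ge0}p_m(t)k^m$, and $p_m=0$ for $m<0$. For a partition $\mu=(\mu_1\ge\dots\ge\mu_l)$, $s_\mu(t)=\det(p_{\mu_i-i+j}(t))_{1\le i,j\le l}$. $[x]=(x,x^2/2,x^3/3,\dots)$, and $\partial_i=\partial/\partial t_i$. A gap sequence of genus $g\ge1$ is a set $G\subset\mathbb Z_{\ge0}$ with $\#G=g$ whose complement $G^c$ contains $0$ and is closed under addition; write $G=\{w_1<\dots<w_g\}$ and $G^c=\{0=w_1^*<w_2^*<\cdots\}$. Its partition is $\lambda=(w_g,\dots,w_1)-(g-1,\dots,1,0)$. For $0\le k\le g-1$: $m_k=\#\{i:w_i^*<g-k\}$,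 $a^{(k)}_j=w_{g-k-j+1}-w_j^*$ ($1\le j\le m_k$), and $c_k=\pm1$ is the sign of the permutation sending $(w_1^*,\dots,w_{m_k}^*,w_{g-k-m_k},\dots,w_1)$ to $(g-k-1,g-k-2,\dots,1,0)$. Conventions: for $k=0$, $s_{(\lambda_1,\dots,\lambda_k)}(\sum_{i=1}^k[x_i])=1$ (and the left side is evaluated at $t=0$); for $k=g$ the product of derivatives is the identity and $c_g=1$. *)

(* Defs.v *)
From mathcomp Require Import all_boot all_order all_algebra.
From mathcomp Require Import mpoly.
Set Implicit Arguments. Unset Strict Implicit. Unset Printing Implicit Defensive.
Import GRing.Theory.
Local Open Scope ring_scope.

(* Polynomials in t = (t_1,...,t_n) are {mpoly rat[n]}; the variable
   'X_j (j : 'I_n) stands for t_(j+1). *)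

Definition Tser (n : nat) : {poly {mpoly rat[n]}} :=
  \sum_(j < n) ('X_j)%:P * 'X^(j.+1).

(* p_m(t) = coefficient of k^m in exp(T(k)) = sum_r T(k)^r / r!;
   since T has no constant term only r <= m contributes. *)
Definition hp (n m : nat) : {mpoly rat[n]} :=
  (\sum_(r < m.+1) ((((r`!)%:R)^-1 : rat)%:MP)%:P * (Tser n) ^+ r)`_m.

Definition pz (n : nat) (z : int) : {mpoly rat[n]} :=
  match z with Posz m => hp n m | Negz _ => 0 end.

Definition schur (n : nat) (mu : seq nat) : {mpoly rat[n]} :=
  \det (\matrix_(i < size mu, j < size mu)
          pz n ((nth 0%N mu i)%:Z - (i : nat)%:Z + (j : nat)%:Z)).

(* evaluation at t = [x_1] + ... + [x_k], i.e. t_m = sum_i x_i^m / m *)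
Definition evalx (n k : nat) (p : {mpoly rat[n]}) : {mpoly rat[k]} :=
  comp_mpoly [tuple (((j.+1)%:R)^-1 : rat) *: \sum_(i < k) 'X_i ^+ (j.+1)
             | j < n] p.

Definition dt (n a : nat) (p : {mpoly rat[n]}) : {mpoly rat[n]} :=
  if insub (a.-1) : option 'I_n is Some i then mderiv i p else 0.

Definition gap_seq (g : nat) (w : seq nat) : Prop :=
  [/\ (1 <= g)%N, size w = g, sorted ltn w, 0%N \notin w &
      forall a b : nat, a \notin w -> b \notin w -> (a + b)%N \notin w].

Definition wg (w : seq nat) (i : nat) : nat := nth 0%N w i.-1.

(* w*_j (j >= 1): the j-th element of the complement in increasing order;
   the first size w + j naturals contain at least j non-gaps. *)
Definition wstar (w : seq nat) (j : nat) : nat :=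
  nth 0%N [seq x <- iota 0 (size w + j) | x \notin w] j.-1.

Definition lam (w : seq nat) : seq nat :=
  [seq (wg w (size w - i) - (size w - i.+1))%N | i <- iota 0 (size w)].

(* m_k = #{ i : w*_i < g - k } *)
Definition mk (w : seq nat) (g k : nat) : nat :=
  size [seq x <- iota 0 (g - k) | x \notin w].

Definition ak (w : seq nat) (g k j : nat) : nat :=
  (wg w (g - k - j).+1 - wstar w j)%N.

Definition aks (w : seq nat) (g k : nat) : seq nat :=
  [seq ak w g k j | j <- iota 1 (mk w g k)].

Definition dprod (n : nat) (w : seq nat) (g k : nat) (p : {mpoly rat[n]}) :=
  foldr (fun a q => dt a q) p (aks w g k).

Definition cseq (w : seq nat) (g k : nat) : seq nat :=
  [seq wstar w j | j <- iota 1 (mk w g k)] ++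
  [seq wg w (g - k - mk w g k - i) | i <- iota 0 (g - k - mk w g k)].

(* sign of the permutation sending s to the decreasing sequence
   (size s - 1, ..., 1, 0): (-1)^(# pairs i < j with s_i < s_j) *)
Definition sign_to_decr (s : seq nat) : rat :=
  (-1) ^+ (\sum_(i < size s) \sum_(j < size s | (i < j)%N)
             (nth 0%N s i < nth 0%N s j)%N).

Definition ck (w : seq nat) (g k : nat) : rat := sign_to_decr (cseq w g k).

(* Main.v *)
Require Import Defs.
From mathcomp Require Import all_boot all_order all_algebra.
From mathcomp Require Import mpoly zify ring.
Import GRing.Theory Num.Theory.
Local Open Scope ring_scope.
Set Implicit Arguments. Unset Strict Implicit. Unset Printing Implicit Defensive.

(** With l_i = mu_i + (g-i), s_mu is the determinant with rows
    (p_{l_i - g + j})_j, and d/dt_a lowers one row index l_i by a, summed over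
    all rows.  An iterated derivative is thus a sum over all ways t of
    distributing the a_j over the rows.
    At t = [x_1] + ... + [x_k] the series sum p_m z^m is inverse to
    E(z) = prod (1 - x_i z), of degree k; multiplying by the unitriangular
    matrix of coefficients of E turns every column after the k-th into an
    indicator of "l_i = v", v < q := g-k.  So the determinant vanishes unless
    0, ..., q-1 all occur among the shifted l_i, and is otherwise a block
    determinant.  Counting shows that each of the m_k nongaps below q must be
    produced by exactly one shifted row, and descending induction on j, using
    that w_{q-j+1} - w*_j lowers only the row w_{q-j+1} to a nongap w*_i with
    i <= j, leaves the single term lowering w_{q-j+1} to w*_j. *)

(** * Derivatives of shifted determinants *)

(** Only the product rule is assumed, so that the [leibniz] lemmas serve [mderiv], its
    coefficientwise extension to polynomials, and the formal derivative alike. *)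
Lemma leibniz1 (R : comNzRingType) (D : R -> R) :
  (forall p q, D (p * q) = D p * q + p * D q) -> D 1 = 0.
Proof.
by move=> DM; apply: (addrI (D 1)); rewrite addr0 -[in RHS](mulr1 1) DM mulr1 mul1r.
Qed.

Lemma leibniz_expr (R : comNzRingType) (D : R -> R) x r :
  (forall p q, D (p * q) = D p * q + p * D q) ->
  D (x ^+ r) = x ^+ r.-1 * D x *+ r.
Proof.
move=> DM; elim: r => [|r IH]; first by rewrite expr0 mulr0n leibniz1.
rewrite exprS DM IH /= mulrnAr mulrA mulrS [D x * _]mulrC.
by case: r {IH} => [|r]; rewrite ?mulr0n //= -exprS.
Qed.

Lemma leibniz_prod (R : comNzRingType) (D : R -> R) (I : eqType) (r : seq I) F :
  (forall p q, D (p * q) = D p * q + p * D q) -> uniq r ->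
  D (\prod_(i <- r) F i)
  = \sum_(j <- r) \prod_(i <- r) (if i == j then D (F i) else F i).
Proof.
move=> DM; elim: r => [|x r IH] /=; first by rewrite !big_nil leibniz1.
case/andP=> xr ur; rewrite !big_cons DM IH // eqxx; congr (_ * _ + _).
  by apply: eq_big_seq => i ir; rewrite (negPf (memPn xr _ ir)).
rewrite mulr_sumr; apply: eq_big_seq => j jr.
by rewrite big_cons eq_sym (negPf (memPn xr _ jr)).
Qed.

Lemma mderiv_det n (R : comNzRingType) (a : 'I_n) m (A : 'M[{mpoly R[n]}]_m) :
  mderiv a (\det A)
  = \sum_(r < m) \det (\matrix_(i, j) if i == r then mderiv a (A i j) else A i j).
Proof.
have sgn (b : bool) p : mderiv a ((-1) ^+ b * p) = (-1) ^+ b * mderiv a p.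
  by case: b; rewrite ?mulN1r ?mul1r ?raddfN.
rewrite /determinant raddf_sum exchange_big /=; apply: eq_bigr => s _.
rewrite -mulr_sumr sgn (leibniz_prod _ (mderivM a)) ?index_enum_uniq //; congr (_ * _).
by apply: eq_bigr => j _; apply: eq_bigr => i _; rewrite mxE.
Qed.

(** * Truncated exponentials and their derivatives *)

Definition expt (n N : nat) : {poly {mpoly rat[n]}} :=
  \sum_(r < N.+1) ((((r`!)%:R)^-1 : rat)%:MP)%:P * (Tser n) ^+ r.

Lemma TserE n : Tser n = (\sum_(j < n) ('X_j)%:P * 'X^j) * 'X.
Proof.
rewrite /Tser mulr_suml; apply: eq_bigr => j _.
by rewrite -mulrA -exprSr.
Qed.

Lemma coef_Tser_expr n r m : (m < r)%N -> ((Tser n) ^+ r)`_m = 0.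
Proof. by move=> lt; rewrite TserE exprMn coefMXn lt. Qed.

(** One truncation order serves all coefficients up to [N]: [Tser n] has no constant term, so powers
    beyond the [m]-th do not reach degree [m]. *)
Lemma coef_expt n N m : (m <= N)%N -> (expt n N)`_m = hp n m.
Proof.
move=> le; rewrite /hp /expt !coef_sum.
rewrite [RHS](big_ord_widen N.+1 (fun r => ((((r`!)%:R)^-1 : rat)%:MP%:P * (Tser n) ^+ r)`_m)) //.
rewrite [LHS](bigID (fun r : 'I_N.+1 => (r < m.+1)%N)) /= [X in _ + X]big1 ?addr0 //.
by move=> r; rewrite -leqNgt => lt; rewrite coefCM coef_Tser_expr ?mulr0.
Qed.

Lemma mderiv_map_polyM n (a : 'I_n) (p q : {poly {mpoly rat[n]}}) :
  map_poly (mderiv a) (p * q) = map_poly (mderiv a) p * q + p * map_poly (mderiv a) q.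
Proof.
apply/polyP=> m; rewrite coefD coef_map !coefM raddf_sum -big_split.
by apply: eq_bigr => i _ /=; rewrite mderivM !coef_map.
Qed.

Lemma mderiv_Tser n (a : 'I_n) : map_poly (mderiv a) (Tser n) = 'X^(a.+1).
Proof.
rewrite /Tser raddf_sum (bigD1 a) //= [X in _ + X]big1 ?addr0; last first.
  move=> j ja; apply/polyP=> m; rewrite coef_map coefCM coefXn coef0.
  case: eqP => _; rewrite ?mulr0 ?mulr1 ?raddf0 //.
  by rewrite /= mderivX mnmE (negPf ja) scale0r.
apply/polyP=> m; rewrite coef_map coefCM !coefXn.
case: eqP => _; rewrite ?mulr0 ?mulr1 ?raddf0 //.
rewrite /= mderivX mnmE eqxx scale1r [(_ - _)%MM](_ : _ = 0%MM) ?mpolyX0 //.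
by apply/mnmP=> i; rewrite mnmBE mnm0E subnn.
Qed.

Lemma mderiv_Tser_expr n (a : 'I_n) r :
  map_poly (mderiv a) ((Tser n) ^+ r) = (Tser n) ^+ r.-1 * 'X^(a.+1) *+ r.
Proof. by rewrite (leibniz_expr _ _ (mderiv_map_polyM a)) mderiv_Tser. Qed.

(** The exponential law holds exactly, at the price of one truncation order: T^r / r! becomes
    T^(r-1) / (r-1)! times ['X^(a.+1)]. *)
Lemma mderiv_expt n (a : 'I_n) N :
  map_poly (mderiv a) (expt n N.+1) = expt n N * 'X^(a.+1).
Proof.
have DC (c : rat) : map_poly (mderiv a) (c%:MP)%:P = 0.
  by rewrite map_polyC /= mderivC polyC0.
rewrite /expt raddf_sum big_ord_recl /= expr0 mulr1 DC add0r mulr_suml.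
apply: eq_bigr => r _; rewrite mderiv_map_polyM DC mul0r add0r.
rewrite mderiv_Tser_expr /= mulrnAr -mulrnAl mulrA; congr (_ * _ * _).
have -> : (r`!%:R^-1 : rat) = (r.+1)`!%:R^-1 *+ r.+1.
  by rewrite -[RHS]mulr_natl factS natrM invfM mulrA mulfV ?mul1r // pnatr_eq0.
by rewrite mpolyCMn polyCMn.
Qed.

Lemma mderiv_hp n (a : 'I_n) m :
  mderiv a (hp n m) = if (a.+1 <= m)%N then hp n (m - a.+1) else 0.
Proof.
rewrite -(@coef_expt n m.+1) // -coef_map mderiv_expt coefMXn ltnS.
by rewrite leqNgt; case: ltnP => //= lt; rewrite coef_expt // leq_subr.
Qed.

(** Integer indices make the rule uniform, since [pz] vanishes at negative ones; the bound on [a]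
    keeps [dt] away from its default value. *)
Lemma dt_pz n a z : (0 < a <= n)%N -> dt a (pz n z) = pz n (z - a%:Z).
Proof.
case: a => // a /= an; rewrite /dt /= insubT /=.
case: z => [m|m].
  rewrite /= mderiv_hp /=; case: ltnP => lt; first by rewrite subzn.
  by have -> : (m%:Z - a.+1%:Z)%R = Negz (a - m) by lia.
have -> : (Negz m - a.+1%:Z)%R = Negz (m + a.+1) by lia.
by rewrite /= raddf0.
Qed.

(** The row indices are integers because repeated lowering may make them negative. *)
Definition shdet n m (l : 'I_m -> int) : {mpoly rat[n]} :=
  \det (\matrix_(i < m, j < m) pz n (l i - (rev_ord j)%:Z)).

Lemma eq_shdet n m (l l' : 'I_m -> int) : l =1 l' -> shdet n l = shdet n l'.
Proof. by move=> e; congr (\det _); apply/matrixP=> i j; rewrite !mxE e. Qed.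

Lemma schurE n mu m : size mu = m ->
  schur n mu = shdet n (fun i : 'I_m => (nth 0%N mu i + rev_ord i)%:Z).
Proof.
move=> <-; congr (\det _); apply/matrixP=> i j; rewrite !mxE; congr (pz n _).
by have := ltn_ord i; have := ltn_ord j; rewrite /=; lia.
Qed.

Lemma dt_shdet n m a (l : 'I_m -> int) : (0 < a <= n)%N ->
  dt a (shdet n l) =
  \sum_(r < m) shdet n (fun i => l i - (if r == i then a else 0%N)%:Z).
Proof.
move=> an; have an' : (a.-1 < n)%N by lia.
have dtE p : dt a p = mderiv (Ordinal an') p by rewrite /dt insubT.
rewrite dtE mderiv_det; apply: eq_bigr => r _; congr (\det _).
apply/matrixP=> i j; rewrite !mxE eq_sym; case: eqP => _; last by rewrite subr0.
by rewrite -dtE dt_pz // addrAC.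
Qed.

Lemma big_tuple_cons (R : nmodType) (T : finType) m (F : m.+1.-tuple T -> R) :
  \sum_t F t = \sum_x \sum_(t : m.-tuple T) F (cons_tuple x t).
Proof.
rewrite pair_big /= (reindex (fun p : T * m.-tuple T => cons_tuple p.1 p.2)) //=.
exists (fun t : m.+1.-tuple T => (thead t, behead_tuple t)) => [[x t] _|t _] /=.
  by congr (_, _); apply: val_inj.
by rewrite [in RHS](tuple_eta t).
Qed.

(** A tuple [t] assigns the [j]-th derivative to row [tnth t j]; this is the total lowering of row
    [i]. *)
Definition shift m (s : seq nat) (t : (size s).-tuple 'I_m) (i : 'I_m) : nat :=
  \sum_(j < size s | tnth t j == i) nth 0%N s j.

Lemma dt_foldr_shdet n m (s : seq nat) (l : 'I_m -> int) :
  all (fun a => 0 < a <= n)%N s ->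
  foldr (fun a q => dt a q) (shdet n l) s =
  \sum_(t : (size s).-tuple 'I_m) shdet n (fun i => l i - (shift t i)%:Z).
Proof.
elim: s => [_|a s IH /= /andP[an sn]].
  rewrite (bigD1 [tuple]) //= big1 ?addr0 => [|t]; last by case/eqP; exact: tuple0.
  by apply: eq_shdet => i; rewrite /shift big_ord0 subr0.
have dtD : {morph @dt n a : p q / p + q} by move=> p q; rewrite /dt; case: insubP => *; rewrite ?raddfD ?addr0.
have dt0 : @dt n a 0 = 0 by rewrite /dt; case: insubP => *; rewrite ?raddf0.
rewrite IH // (big_morph _ dtD dt0) big_tuple_cons exchange_big.
apply: eq_bigr => t _; rewrite dt_shdet //; apply: eq_bigr => x _.
apply: eq_shdet => i; rewrite /shift -addrA -opprD; congr (_ - _).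
rewrite big_mkcond [in RHS]big_mkcond big_ord_recl /= addrC PoszD; congr (_ + _).
by congr Posz; apply: eq_bigr => j _; rewrite tnthS.
Qed.

(** * The generating series at power sums *)

Section NewtonSeries.
Variables (R : comAlgType rat) (n k : nat) (x : 'I_k -> R).

(** [psum j] is the power sum of degree [j.+1]. Up to degree [n], [psumser] is minus the logarithm
    of [elemgen]. *)
Definition psum j := \sum_(i < k) x i ^+ j.+1.
Definition psumser : {poly R} :=
  \sum_(j < n) ((j.+1%:R)^-1 *: psum j)%:P * 'X^(j.+1).
Definition completegen : {poly R} :=
  \sum_(r < n.+1) ((((r`!)%:R)^-1 : rat)%:A)%:P * psumser ^+ r.
Definition elemgen : {poly R} := \prod_(i < k) (1 - (x i)%:P * 'X).

Lemma scaler_natVK (m : nat) (y : R) : m.+1%:R^-1 *: y *+ m.+1 = y.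
Proof. by rewrite -scaler_nat scalerA mulfV ?scale1r // pnatr_eq0. Qed.

Lemma coef0_elemgen : elemgen`_0 = 1.
Proof.
rewrite -horner_coef0 horner_prod big1 // => i _.
by rewrite hornerD hornerN hornerM hornerX mulr0 subr0 hornerC.
Qed.

Lemma size_elemgen : (size elemgen <= k.+1)%N.
Proof.
apply: leq_trans (size_prod_leq _ _) _; rewrite cardE size_enum_ord.
have le : (\sum_(i < k) size (1 - (x i)%:P * 'X)%R <= \sum_(i < k) 2)%N.
  apply: leq_sum => i _; rewrite addrC -mulNr -polyCN -[X in _ + X]polyC1 size_MXaddC.
  by case: ifP => // _; rewrite ltnS size_polyC_leq1.
by rewrite sum_nat_const card_ord muln2 -addnn in le; rewrite leq_subLR addnS ltnS.
Qed.

Lemma deriv_psumser : psumser^`() = \sum_(j < n) (psum j)%:P * 'X^j.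
Proof.
rewrite /psumser raddf_sum; apply: eq_bigr => j _ /=.
by rewrite derivM derivC mul0r add0r derivXn mulrnAr -mulrnAl -polyCMn scaler_natVK.
Qed.

Lemma psumserE :
  psumser = (\sum_(j < n) ((j.+1%:R)^-1 *: psum j)%:P * 'X^j) * 'X.
Proof.
by rewrite /psumser mulr_suml; apply: eq_bigr => j _; rewrite -mulrA -exprSr.
Qed.

(** Differentiation loses the last term of the truncated exponential; that term contains
    [psumser ^+ n], a multiple of ['X^n]. *)
Lemma deriv_completegen :
  exists V, completegen^`() = psumser^`() * completegen - V * 'X^n.
Proof.
exists (psumser^`() * ((((n`!)%:R)^-1 : rat)%:A)%:P *
  (\sum_(j < n) ((j.+1%:R)^-1 *: psum j)%:P * 'X^j) ^+ n).
rewrite -!mulrA -exprMn -psumserE {2}/completegen big_ord_recr /= mulrDr addrK.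
rewrite /completegen raddf_sum big_ord_recl /= expr0 mulr1 derivC add0r mulr_sumr.
apply: eq_bigr => r _; rewrite derivM derivC mul0r add0r deriv_exp /=.
rewrite mulrnAr -mulrnAl mulrCA mulrA mulrA; congr (_ * _); congr (_ * _).
rewrite -polyCMn scalerMnl; congr ((_ *: _)%:P).
by rewrite -[_ *+ _]mulr_natl factS natrM invfM mulrA mulfV ?mul1r // pnatr_eq0.
Qed.

(** This is the logarithmic derivative cleared of denominators: E'/E is minus the sum of x_i / (1 -
    x_i z), and the derivative of [psumser] sums the geometric series of these fractions cut after
    [n] terms. The tails give the multiple of ['X^n]. *)
Lemma deriv_elemgen :
  exists V, elemgen * psumser^`() + elemgen^`() = V * 'X^n.
Proof.
pose E i := \prod_(l < k) (if l == i then 1 else 1 - (x l)%:P * 'X).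
have Ei i : elemgen = E i * (1 - (x i)%:P * 'X).
  rewrite /elemgen /E (bigD1 i) //= [in RHS](bigD1 i) //= eqxx mul1r mulrC.
  by congr (_ * _); apply: eq_bigr => l /negPf ->.
exists (- \sum_i E i * (x i ^+ n.+1)%:P).
have -> : elemgen^`() = - \sum_i E i * (x i)%:P.
  rewrite /elemgen (leibniz_prod _ (@derivM R)) ?index_enum_uniq // -sumrN.
  apply: eq_bigr => i _; rewrite (bigD1 i) //= eqxx /E [in RHS](bigD1 i) //= eqxx mul1r.
  rewrite [_^`()](_ : _ = - (x i)%:P) ?mulNr ?(mulrC (x i)%:P); last first.
    by rewrite derivB derivM derivX !derivC mulr0 addr0 mul1r sub0r.
  by congr (- (_ * _)); apply: eq_bigr => l /negPf ->.
have -> : psumser^`() = \sum_i (x i)%:P * \sum_(j < n) ((x i)%:P * 'X) ^+ j.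
  rewrite deriv_psumser; under eq_bigr do rewrite /psum rmorph_sum /= mulr_suml.
  rewrite exchange_big; apply: eq_bigr => i _; rewrite mulr_sumr.
  by apply: eq_bigr => j _; rewrite exprMn mulrA exprS polyCM rmorphXn.
rewrite mulr_sumr mulNr -sumrN mulr_suml -sumrN -big_split /=; apply: eq_bigr => i _.
have := subrX1 ((x i)%:P * 'X) n; rewrite (Ei i).
set S := \sum_(_ < n) _ => eS.
have -> : E i * (1 - (x i)%:P * 'X) * ((x i)%:P * S) =
  - (E i * (x i)%:P * (((x i)%:P * 'X - 1) * S)) by ring.
by rewrite -eS exprMn exprS polyCM rmorphXn /=; ring.
Qed.

(** By the two differential equations the derivative of the product is a multiple of ['X^n];
    division by m+1 is possible over the rationals. *)
Lemma elemgen_completegen m : (m < n)%N -> (elemgen * completegen)`_m.+1 = 0.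
Proof.
move=> mn; have [V VE] := deriv_completegen; have [U UE] := deriv_elemgen.
have: ((elemgen * completegen)^`())`_m = 0.
  rewrite derivM VE.
  have -> : elemgen^`() * completegen + elemgen * (psumser^`() * completegen - V * 'X^n)
    = (U * completegen - elemgen * V) * 'X^n by rewrite mulrBl -mulrAC -UE; ring.
  by rewrite coefMXn mn.
by rewrite coef_deriv => e; rewrite -[LHS](scaler_natVK m) scalerMnr e scaler0.
Qed.

Lemma coef0_completegen : completegen`_0 = 1.
Proof.
rewrite /completegen big_ord_recl coefD expr0 mulr1 coefC invr1 scale1r coef_sum.
by rewrite big1 ?addr0 // => r _; rewrite coefCM psumserE exprMn coefMXn mulr0.
Qed.

End NewtonSeries.

(** * Column reduction *)

Lemma sum_ord_widen0 (V : nmodType) (f : nat -> V) a b :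
  (a <= b)%N -> (forall d, (a <= d)%N -> f d = 0) ->
  \sum_(d < b) f d = \sum_(d < a) f d.
Proof.
move=> ab f0; rewrite [RHS](big_ord_widen b f ab) [LHS](bigID (fun d : 'I_b => (d < a)%N)) /=.
by rewrite [X in _ + X]big1 ?addr0 // => d; rewrite -leqNgt => /f0.
Qed.

Section ColumnReduction.
Variables (R : comNzRingType) (h : int -> R) (E : {poly R}) (n k : nat).
Hypothesis h_neg : forall m, h (Negz m) = 0.
Hypothesis hE : forall m, (m <= n)%N ->
  \sum_(d < m.+1) E`_d * h (m - d)%N%:Z = (m == 0%N)%:R.
Hypothesis E0 : E`_0 = 1.
Hypothesis sE : (size E <= k.+1)%N.

(** [hE] sums exactly up to [m]. Here the range may end anywhere from [k] on: the terms by which the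
    ranges differ vanish by [sE] or [h_neg], and for negative [z] all terms do. *)
Lemma truncated_conv (z : int) j : (z <= n%:Z)%R -> (k <= j)%N ->
  \sum_(d < j.+1) E`_d * h (z - d%:Z) = (z == 0)%:R.
Proof.
case: z => [m|m] zn kj; last first.
  rewrite big1 // => d _; have -> : (Negz m - d%:Z)%R = Negz (m + d) by lia.
  by rewrite h_neg mulr0.
rewrite -[RHS]hE //; pose f d := E`_d * h (m%:Z - d%:Z).
have f0 d : (k < d)%N -> f d = 0.
  by move=> kd; rewrite /f nth_default ?mul0r // (leq_trans sE).
have f1 d : (m < d)%N -> f d = 0.
  move=> md; rewrite /f; have -> : (m%:Z - d%:Z)%R = Negz (d - m.+1) by lia.
  by rewrite h_neg mulr0.
transitivity (\sum_(d < (maxn j m).+1) f d).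
  by apply/esym/sum_ord_widen0 => [|d jd]; [lia | apply: f0; lia].
rewrite (@sum_ord_widen0 _ f m.+1); [|by lia|exact: f1].
by apply: eq_bigr => d _; rewrite /f subzn // -ltnS.
Qed.

Definition convmx m : 'M[R]_m := \matrix_(i, j) if (i <= j)%N then E`_(j - i) else 0.

Lemma det_convmx m : \det (convmx m) = 1.
Proof.
rewrite -det_tr det_trig; last first.
  by apply/is_trig_mxP => i j ij; rewrite !mxE leqNgt ij.
by apply: big1 => i _; rewrite !mxE leqnn subnn E0.
Qed.

Definition shiftmx m (l : 'I_m -> int) : 'M[R]_m :=
  \matrix_(i, j) h (l i - (rev_ord j)%:Z).

(** The entry is the convolution at l_i - (m-1-j), summed over the column distance d = j - j'. *)
Lemma shiftmx_convmx m (l : 'I_m -> int) i (j : 'I_m) :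
  (l i <= n%:Z)%R -> (k <= j)%N ->
  (shiftmx l *m convmx m) i j = (l i == (rev_ord j)%:Z)%:R.
Proof.
move=> ln kj; rewrite mxE -subr_eq0 -(@truncated_conv _ j) //; last by lia.
pose f j' := h (l i - (m - j'.+1)%N%:Z) * (if (j' <= j)%N then E`_(j - j') else 0).
transitivity (\sum_(j' < m) f j'); first by apply: eq_bigr => j' _; rewrite !mxE.
rewrite (@sum_ord_widen0 _ f j.+1) //; last first.
  by move=> d jd; rewrite /f leqNgt jd mulr0.
rewrite (reindex_inj rev_ord_inj); apply: eq_bigr => d _.
have dj := ltn_ord d; have jm := ltn_ord j; rewrite /f /= mulrC.
have -> : (j.+1 - d.+1 <= j)%N by lia.
have -> : (j - (j.+1 - d.+1) = d)%N by lia.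
by congr (_ * h _); lia.
Qed.

Lemma det_shiftmx_eq0 m (l : 'I_m -> int) v :
  (forall i, (l i <= n%:Z)%R) -> (v < m - k)%N ->
  (forall i, l i != v%:Z) -> \det (shiftmx l) = 0.
Proof.
move=> ln vm lv; rewrite -[LHS]mulr1 -(det_convmx m) -det_mulmx.
(* This column tests for the value [v]; the bound [v < m - k] puts its index at [k] or later. *)
have jm : (m - v.+1 < m)%N by lia.
rewrite (expand_det_col _ (Ordinal jm)) big1 // => i _.
rewrite shiftmx_convmx //=; last by lia.
suff /negPf-> : l i != (m - (m - v.+1).+1)%N%:Z by rewrite mul0r.
by have -> : (m - (m - v.+1).+1 = v)%N by lia.
Qed.

(** For a bijection [c] onto 0, ..., q-1 this is a permutation matrix, the identity when [c]
    decreases. *)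
Definition revmx q (c : 'I_q -> int) : 'M[R]_q :=
  \matrix_(i, j) (c i == (rev_ord j)%:Z)%:R.

(** The indicators of values below [q] vanish on the first [k] rows, so the reduced matrix is block
    lower triangular. *)
Lemma det_shiftmx_block q (l : 'I_(k + q) -> int) :
  (forall i, (l i <= n%:Z)%R) -> (forall i, (q%:Z <= l (lshift q i))%R) ->
  \det (shiftmx l) =
  \det (shiftmx (fun i => l (lshift q i) - q%:Z)) * \det (revmx (fun i => l (rshift k i))).
Proof.
move=> ln lq; rewrite -[LHS]mulr1 -(det_convmx (k + q)) -det_mulmx.
move EB : (_ *m _) => B.
have BE i (j : 'I_(k + q)) : (k <= j)%N -> B i j = (l i == (rev_ord j)%:Z)%:R.
  by rewrite -EB; apply: shiftmx_convmx.
have Bur : ursubmx B = 0.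
  apply/matrixP=> i j; rewrite !mxE BE /= ?leq_addr //.
  have := lq i; have := ltn_ord j.
  by case: eqP => //; lia.
have Bdr : drsubmx B = revmx (fun i => l (rshift k i)).
  apply/matrixP=> i j; rewrite !mxE BE /= ?leq_addr //.
  by rewrite -addnS subnDl.
(* An upper triangular multiplier mixes the first [k] columns only among themselves. Subtracting [q]
   accounts for [rev_ord] taken in ['I_k] instead of ['I_(k + q)]. *)
have Bul : ulsubmx B = shiftmx (fun i => l (lshift q i) - q%:Z) *m convmx k.
  rewrite -EB; apply/matrixP=> i j; rewrite !mxE big_split_ord /= [X in _ + X]big1 ?addr0.
    apply: eq_bigr => j' _; rewrite !mxE /=; congr (h _ * _).
    by have := ltn_ord j'; lia.
  by move=> j' _; rewrite !mxE /= leqNgt ltn_addr ?mulr0.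
by rewrite -[B]submxK Bur det_lblock Bul Bdr det_mulmx det_convmx mulr1.
Qed.

End ColumnReduction.

(** * The sign of a reversal matrix *)

Lemma sgr_Vandermonde (R : realDomainType) n (a : 'rV[R]_n) :
  Num.sg (\det (Vandermonde n a)) =
  \prod_(i < n) \prod_(j < n | (i < j)%N) Num.sg (a 0 j - a 0 i).
Proof.
rewrite det_Vandermonde (big_morph _ (@sgrM R) (@sgr1 R)); apply: eq_bigr => i _.
by rewrite (big_morph _ (@sgrM R) (@sgr1 R)).
Qed.

(* A permutation matrix P multiplies the Vandermonde determinant of the nodes
   by det P, so the sign of det P is read off the product formula. *)
Lemma det_revmx_int q (c : 'I_q -> nat) : injective c -> (forall i, (c i < q)%N) ->
  \det (revmx int (fun i => (c i)%:Z)) =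
  (-1) ^+ (\sum_(i < q) \sum_(j < q | (i < j)%N) (c i < c j)%N).
Proof.
move=> cI cq; set P := revmx _ _.
pose c' i := rev_ord (Ordinal (cq i)).
have Pij i j : P i j = (j == c' i)%:R.
  rewrite mxE; congr (nat_of_bool _)%:R.
  rewrite -(inj_eq rev_ord_inj) rev_ordK -val_eqE /= eq_sym; lia.
clearbody P; have c'I : injective c' by move=> i j /rev_ord_inj [] /cI.
have P2 : P *m P^T = 1%:M.
  apply/matrixP=> i j; rewrite !mxE (bigD1 (c' i)) //= big1 => [|l lc].
    by rewrite !mxE !Pij eqxx mul1r addr0 (inj_eq c'I).
  by rewrite Pij (negPf lc) mul0r.
have detP2 : \det P ^+ 2 = 1 by rewrite expr2 -{2}det_tr -det_mulmx P2 det1.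
have detP : \det P = Num.sg (\det P).
  by move/eqP: detP2; rewrite sqrf_eq1 => /orP[] /eqP ->; rewrite ?sgrN sgr1.
pose b : 'rV[int]_q := \row_j (rev_ord j)%:Z; pose a : 'rV[int]_q := \row_i (c i)%:Z.
have Vab : Vandermonde q a = Vandermonde q b *m P^T.
  apply/matrixP=> e i; rewrite !mxE (bigD1 (c' i)) //= big1 => [|l lc].
    rewrite !mxE Pij eqxx mulr1 addr0; congr (_ ^+ _).
    by have := cq i; rewrite /= ; lia.
  by rewrite [P^T _ _]mxE Pij (negPf lc) mulr0.
have sgb (i j : 'I_q) : (i < j)%N -> Num.sg (b 0 j - b 0 i) = -1.
  by move=> ij; rewrite ltr0_sg // !mxE /=; have := ltn_ord j; lia.
(* All differences of the decreasing nodes [b] have sign -1; for [a] the sign changes exactly when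
   [c i < c j]. *)
have sga (i j : 'I_q) : (i < j)%N ->
    Num.sg (a 0 j - a 0 i) = Num.sg (b 0 j - b 0 i) * (-1) ^+ (c i < c j)%N.
  move=> ij; rewrite sgb // !mxE; case: ltngtP => [lt|lt|/cI eq_ij].
  - by rewrite gtr0_sg ?expr1 ?mulrNN ?mulr1 //; lia.
  - by rewrite ltr0_sg ?expr0 ?mulr1 //; lia.
  - by rewrite eq_ij ltnn in ij.
have := congr1 (fun M => Num.sg (\det M)) Vab.
rewrite det_mulmx det_tr sgrM -detP !sgr_Vandermonde.
under eq_bigr => i _ do
  under eq_bigr => j ij do rewrite (sga _ _ ij).
under eq_bigr => i _ do rewrite big_split /= -expr_sum.
rewrite big_split /= -expr_sum => /mulfI -> //.
apply/prodf_neq0 => i _; apply/prodf_neq0 => j ij.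
by rewrite sgb.
Qed.

(** The sign argument takes place in an ordered ring; its result is carried from the integers to [R]
    by the canonical morphism. *)
Lemma det_revmx (R : comNzRingType) q (c : 'I_q -> nat) :
  injective c -> (forall i, (c i < q)%N) ->
  \det (revmx R (fun i => (c i)%:Z)) =
  (-1) ^+ (\sum_(i < q) \sum_(j < q | (i < j)%N) (c i < c j)%N).
Proof.
move=> cI cq; have := congr1 (fun z : int => z%:~R : R) (det_revmx_int cI cq).
rewrite -det_map_mx /= rmorphXn rmorphN1 => <-; congr (\det _).
by apply/matrixP=> i j; rewrite !mxE; case: (_ == _).
Qed.

(** * Evaluation and the surviving term *)

Section Evaluation.
Variables n k : nat.

Definition hx (z : int) : {mpoly rat[k]} := evalx k (pz n z).

Let X (i : 'I_k) : {mpoly rat[k]} := 'X_i.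

Lemma evalx_expt : map_poly (@evalx n k) (expt n n) = completegen n X.
Proof.
rewrite /evalx; set u := [tuple _ | _ < _].
change (map_poly (comp_mpoly u) (expt n n) = completegen n X).
rewrite /expt /completegen rmorph_sum; apply: eq_bigr => r _.
rewrite rmorphM rmorphXn /= map_polyC /= comp_mpolyC; congr (_%:P * _ ^+ _).
  by rewrite -mul_mpolyC mulr1.
rewrite /Tser /psumser rmorph_sum; apply: eq_bigr => j _ /=.
rewrite rmorphM /= map_polyXn map_polyC /= comp_mpolyXU; congr (_%:P * _).
by rewrite -tnth_nth tnth_mktuple.
Qed.

Lemma hx_Posz m : (m <= n)%N -> hx m%:Z = (completegen n X)`_m.
Proof. by move=> mn; rewrite -evalx_expt coef_map /= coef_expt. Qed.

Lemma hx_Negz m : hx (Negz m) = 0.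
Proof. by rewrite /hx /evalx raddf0. Qed.

(** This supplies the hypothesis [hE] of the column reduction. *)
Lemma elemgen_hx m : (m <= n)%N ->
  \sum_(d < m.+1) (elemgen X)`_d * hx (m - d)%N%:Z = (m == 0%N)%:R.
Proof.
move=> mn; transitivity ((elemgen X * completegen n X)`_m).
  rewrite coefM; apply: eq_bigr => d _; rewrite hx_Posz //.
  by rewrite (leq_trans (leq_subr _ _)).
case: m mn => [_|m mn]; last exact: elemgen_completegen.
by rewrite coef0M coef0_elemgen coef0_completegen mul1r.
Qed.

Lemma evalx_shdet m (l : 'I_m -> int) :
  evalx k (shdet n l) = \det (shiftmx hx l).
Proof.
rewrite /evalx /shdet -det_map_mx; congr (\det _).
by apply/matrixP=> i j; rewrite !mxE.
Qed.

End Evaluation.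

(** * Uniqueness of the surviving distribution *)

Lemma shift_notin m (s : seq nat) (t : (size s).-tuple 'I_m) i :
  i \notin t -> shift t i = 0%N.
Proof.
move=> it; apply: big_pred0 => j; apply/negP => /eqP ti.
by rewrite -ti mem_tnth in it.
Qed.

Lemma shift_tnth m (s : seq nat) (t : (size s).-tuple 'I_m) j :
  uniq t -> shift t (tnth t j) = nth 0%N s j.
Proof.
move=> /tuple_uniqP tI; rewrite /shift (big_pred1 j) // => i /=.
by rewrite (inj_eq tI).
Qed.

Section UniqueShift.
Variables (k q : nat) (s v : seq nat) (b : nat -> nat) (l : 'I_(k + q) -> nat).
Hypotheses (sq : (size s <= q)%N) (szv : size v = size s).
Hypotheses (v_sorted : sorted ltn v) (vq : all (gtn q) v).
Hypothesis sE : forall j, (j < size s)%N -> nth 0%N s j = (b j - nth 0%N v j)%N.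
Hypothesis b_decr : forall i j, (i < j < q)%N -> (b j < b i)%N.
Hypothesis b_large : forall i, (i < size s)%N -> (q <= b i)%N.
Hypothesis b_small : forall i, (size s <= i < q)%N -> (b i < q)%N.
Hypothesis bv : forall i, (i < q)%N -> b i \notin v.
Hypothesis lr : forall i, l (rshift k i) = b i.
Hypothesis ll : forall i, (0 < q)%N -> (b 0 < l (lshift q i))%N.
Hypothesis lq : forall i, (q <= l (lshift q i))%N.

Let nth_vq j : (j < size s)%N -> (nth 0%N v j < q)%N.
Proof. by rewrite -szv => jv; apply: (allP vq); rewrite mem_nth. Qed.

Let b_inj i j : (i < q)%N -> (j < q)%N -> b i = b j -> i = j.
Proof.
move=> iq jq e; case: (ltngtP i j) => // ij.
  by have := @b_decr i j; rewrite ij jq e ltnn => /(_ isT).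
by have := @b_decr j i; rewrite ij iq e ltnn => /(_ isT).
Qed.

(** In the application [b] lists the gaps w_q > ... > w_1 and [v] the nongaps below [q]. No [l i]
    lies in [v], so its elements come from lowered rows; as there are only [size v] lowerings, these
    rows are distinct and produce exactly [v]. *)
Lemma unique_shift (t : (size s).-tuple 'I_(k + q)) :
  (forall u, (u < q)%N -> exists i, (l i)%:Z - (shift t i)%:Z = u%:Z) ->
  forall j, tnth t j = (k + j)%N :> nat.
Proof.
pose f i := (l i)%:Z - (shift t i)%:Z => f_onto.
have lv i : l i \notin v.
  have [i' ->|i' ->] := split_ordP i; last by rewrite lr bv.
  by apply/negP => /(allP vq) /=; rewrite ltnNge lq.
have f_notin i : i \notin t -> f i = (l i)%:Z.
  by move=> it; rewrite /f shift_notin // subr0.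
have sub : {subset map Posz v <= map f t}.
  move=> _ /mapP[u uv ->]; have [i fi] := f_onto _ (allP vq _ uv).
  apply/mapP; exists i => //; apply/negPn/negP => it.
  by move: fi; rewrite -/(f i) f_notin // => -[] e; move: (lv i); rewrite e uv.
have v_uniq : uniq v by rewrite (sorted_uniq ltn_trans ltnn).
have szft : (size (map f t) <= size (map Posz v))%N by rewrite !size_map size_tuple szv.
have Pv_uniq : uniq (map Posz v) by rewrite map_inj_uniq // => x y [].
have ft_uniq := leq_size_uniq Pv_uniq sub szft.
have [_ vft] := uniq_min_size Pv_uniq sub szft.
have t_uniq := map_uniq ft_uniq; have tI : injective (tnth t) by apply/tuple_uniqP.
have f_inj i j : f (tnth t i) = f (tnth t j) -> i = j.
  have fI : injective (tnth (map_tuple f t)) by apply/tuple_uniqP.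
  by move=> e; apply: fI; rewrite !tnth_map.
have f_tnth j : f (tnth t j) = (l (tnth t j))%:Z - (nth 0%N s j)%:Z.
  by rewrite /f shift_tnth.
have f_in i : i \in t -> exists2 j, (j < size s)%N & f i = (nth 0%N v j)%:Z.
  move=> it; have: f i \in map Posz v by rewrite vft map_f.
  by case/mapP => u /(nthP 0%N)[j jv <-] ->; exists j; rewrite -?szv.
(* The gap b i < q can only come from the row of b i itself, unshifted. *)
have notin_small (i : 'I_q) : (size s <= i)%N -> rshift k i \notin t.
  move=> si; have bi : (b i < q)%N by rewrite b_small // si ltn_ord.
  have [r fr] := f_onto _ bi; rewrite -/(f r) in fr.
  have rt : r \notin t.
    apply/negP => /f_in[j js]; rewrite fr => -[] e.
    by have := bv (ltn_ord i); rewrite e mem_nth ?szv.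
  suff -> : rshift k i = r by [].
  move: fr; rewrite f_notin // => -[]; have [r' er|r' er] := split_ordP r.
    by have := lq r'; rewrite er; lia.
  by rewrite er lr => /b_inj e; congr rshift; apply: val_inj; rewrite /= e.
(* The rows of all indices above [j] are known by induction; v_o is the value produced by the [j]-th
   lowering. *)
move=> j; have [d] := ubnP (size s - j); elim: d j => // d IH j dj.
have js := ltn_ord j; have [o os fo] := f_in _ (mem_tnth j t).
(* Otherwise row [k + o], already known to be lowered to v_o, would share this value with row
   [tnth t j]. *)
have oj : (o <= j)%N.
  rewrite leqNgt; apply/negP => jo.
  have to : tnth t (Ordinal os) = rshift k (Ordinal (leq_trans os sq)).
    by apply: val_inj; rewrite /= IH /=; lia.
  have: f (tnth t (Ordinal os)) = f (tnth t j).
    rewrite fo f_tnth to lr /= sE //.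
    by have := b_large os; have := nth_vq os; lia.
  by move/f_inj => /(congr1 val) /= e; rewrite e ltnn in jo.
have vo : (nth 0%N v o <= nth 0%N v j)%N.
  move: oj; rewrite leq_eqVlt => /orP[/eqP -> //|oj].
  by apply/ltnW/(sorted_ltn_nth ltn_trans) => //; rewrite inE szv.
(* Before lowering, the row index is v_o + s_j, at most v_j + s_j = b_j. *)
have lb : (l (tnth t j) <= b j)%N.
  move: fo; rewrite f_tnth sE //; have := b_large js; have := nth_vq js; lia.
have [i ti|i ti] := split_ordP (tnth t j).
  have q0 : (0 < q)%N by apply: leq_trans sq; apply: leq_ltn_trans js.
  have := ll i q0; rewrite -ti; case: (posnP j) => j0; first by move: lb; rewrite j0; lia.
  by have := @b_decr 0 j; rewrite j0 /=; lia.
move: lb; rewrite ti lr /= => lb; have iq := ltn_ord i.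
congr (k + _)%N; apply/eqP; rewrite eq_sym eqn_leq; apply/andP; split.
  by rewrite leqNgt; apply/negP => ij; have := @b_decr i j; lia.
(* A row [k + i] with [i] beyond [j] either is never lowered or already belongs to index [i]. *)
rewrite leqNgt; apply/negP => ji.
have [si|si] := leqP (size s) i.
  by have := notin_small _ si; rewrite -ti mem_tnth.
have e : tnth t (Ordinal si) = tnth t j.
  by rewrite ti; apply: val_inj; rewrite /= IH /=; lia.
by have := congr1 val (tI _ _ e) => /= e'; rewrite e' ltnn in ji.
Qed.

End UniqueShift.

(** * Gap sequences *)

Lemma sorted_ltn_nth_count (w : seq nat) q i : sorted ltn w -> (i < size w)%N ->
  (nth 0%N w i < q)%N = (i < count (gtn q) w)%N.
Proof.
elim: w i => // x w IH i /= xw iw; have w_sorted := path_sorted xw.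
case: (ltnP x q) => xq; first by case: i iw => [|i] iw //=; rewrite IH.
have wq : all (fun y => ~~ (y < q)%N) w.
  apply: sub_all (order_path_min ltn_trans xw) => y xy.
  by rewrite -leqNgt (leq_trans xq) // ltnW.
have -> : count (gtn q) w = 0%N by apply/eqP; rewrite eqn0Ngt -has_count -all_predC.
apply/negbTE; case: i iw => [|i] iw /=; first by rewrite -leqNgt.
by apply: (allP wq); rewrite mem_nth.
Qed.

Lemma sorted_ltn_nthD (w : seq nat) i d : sorted ltn w -> (i + d < size w)%N ->
  (nth 0%N w i + d <= nth 0%N w (i + d))%N.
Proof.
move=> ws; elim: d => [|d IH] dw; first by rewrite !addn0.
have : (nth 0%N w (i + d) < nth 0%N w (i + d.+1))%N.
  by apply: (sorted_ltn_nth ltn_trans) => //; rewrite ?inE //; lia.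
by have := IH ltac:(lia); lia.
Qed.

Lemma count_gaps (w : seq nat) q : uniq w ->
  (count (gtn q) w + size [seq x <- iota 0 q | x \notin w] = q)%N.
Proof.
move=> wu; rewrite -size_filter.
have -> : size (filter (gtn q) w) = size [seq x <- iota 0 q | x \in w].
  apply: perm_size; apply: uniq_perm; rewrite ?filter_uniq ?iota_uniq // => x.
  by rewrite !mem_filter mem_iota /= andbC.
by rewrite !size_filter (count_predC (mem w)) size_iota.
Qed.

(** The list defining [wstar] has the nongaps below [q] as a prefix, because [q <= size w]. *)
Lemma wstarE (w : seq nat) q j : (q <= size w)%N ->
  (j < size [seq x <- iota 0 q | x \notin w])%N ->
  wstar w j.+1 = nth 0%N [seq x <- iota 0 q | x \notin w] j.
Proof.
move=> qw jv; rewrite /wstar /= -(subnKC (leq_trans qw (leq_addr j.+1 _))).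
by rewrite iotaD filter_cat nth_cat jv.
Qed.

Lemma nth_lam (w : seq nat) i : (i < size w)%N ->
  nth 0%N (lam w) i = (nth 0%N w (size w - i.+1) - (size w - i.+1))%N.
Proof. by move=> iw; rewrite (nth_map 0%N) ?size_iota // nth_iota // /wg subnS. Qed.

(** In a strictly increasing list the entry at position i is at least i, so the subtraction in [lam]
    is not truncated. *)
Lemma nth_lamD (w : seq nat) i : sorted ltn w -> (i < size w)%N ->
  (nth 0%N (lam w) i + (size w - i.+1))%N = nth 0%N w (size w - i.+1).
Proof.
move=> ws iw; rewrite nth_lam // subnK //.
have := @sorted_ltn_nthD w 0 (size w - i.+1) ws; rewrite add0n; lia.
Qed.

Lemma leq_nth_sumn (w : seq nat) i : (nth 0%N w i <= sumn w)%N.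
Proof.
elim: w i => [|x w IH] [|i] //=; first exact: leq_addr.
exact: leq_trans (IH i) (leq_addl _ _).
Qed.

Lemma sign_to_decrE (s : seq nat) q : size s = q ->
  sign_to_decr s = (-1) ^+ (\sum_(i < q) \sum_(j < q | (i < j)%N)
    (nth 0%N s i < nth 0%N s j)%N).
Proof. by move=> <-. Qed.

(** This is the common form of both claims, with g = k + q. [mu_large] keeps the first [k] rows
    above w_q; [mu_n] and [wn] keep all row indices and all a_j at most [n], the range in which the
    evaluated series relation holds. *)
Lemma evalx_dprod_schur (k q n : nat) (w mu : seq nat) :
  sorted ltn w -> size w = (k + q)%N -> size mu = (k + q)%N ->
  (forall i, (k <= i < k + q)%N -> nth 0%N mu i = nth 0%N (lam w) i) ->
  (forall i, (i < k)%N -> (0 < q)%N ->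
     (nth 0%N w q.-1 < nth 0%N mu i + (k + q - i.+1))%N) ->
  (forall i, (i < k)%N -> (nth 0%N mu i + (k + q - i.+1) <= n)%N) ->
  (sumn w <= n)%N ->
  evalx k (dprod w (k + q) k (schur n mu))
  = ck w (k + q) k *: evalx k (schur n (take k mu)).
Proof.
move=> ws szw szmu mu_lam mu_large mu_n wn.
pose v := [seq x <- iota 0 q | x \notin w]; set s := aks w (k + q) k.
have wu : uniq w by rewrite (sorted_uniq ltn_trans ltnn).
have qw : (q <= size w)%N by rewrite szw leq_addl.
have cv := count_gaps q wu; rewrite -/v in cv.
have mkE : mk w (k + q) k = size v by rewrite /mk addKn.
have szs : size s = size v by rewrite size_map size_iota mkE.
have sq : (size s <= q)%N by rewrite szs -cv leq_addl.
pose b i := nth 0%N w (q - i.+1).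
have vq : all (gtn q) v by apply/allP=> x; rewrite mem_filter mem_iota => /andP[].
have v_sorted : sorted ltn v by apply: (sorted_filter ltn_trans); exact: iota_ltn_sorted.
have wsE j : (j < size s)%N -> wstar w j.+1 = nth 0%N v j.
  by rewrite szs; apply: wstarE.
have nth_s j : (j < size s)%N -> nth 0%N s j = (b j - nth 0%N v j)%N.
  move=> js; rewrite (nth_map 0%N) ?size_iota ?mkE -?szs // nth_iota ?mkE -?szs //.
  by rewrite /ak addKn add1n wsE.
have b_decr i j : (i < j < q)%N -> (b j < b i)%N.
  by move=> ijq; apply: (sorted_ltn_nth ltn_trans) => //; rewrite ?inE; lia.
(* [w] has [q - size s] elements below [q], and [b] reads its first [q] entries backwards. *)
have b_q i : (i < q)%N -> (b i < q)%N = (size s <= i)%N.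
  by move=> iq; rewrite sorted_ltn_nth_count //; lia.
have b_large i : (i < size s)%N -> (q <= b i)%N.
  by move=> js; rewrite leqNgt b_q -?ltnNge //; apply: leq_trans sq.
have b_small i : (size s <= i < q)%N -> (b i < q)%N by case/andP=> si iq; rewrite b_q.
have bv i : (i < q)%N -> b i \notin v.
  move=> iq; rewrite mem_filter negb_and negbK mem_nth //. by rewrite szw; lia.
pose l (i : 'I_(k + q)) := (nth 0%N mu i + rev_ord i)%N.
have lr i : l (rshift k i) = b i.
  have iq := ltn_ord i; have := @nth_lamD w (k + i) ws.
  rewrite szw ltn_add2l -addnS subnDl -mu_lam ?leq_addr ?ltn_add2l // => /(_ iq); rewrite /b => <-.
  by rewrite /l /= -addnS subnDl.
have ll i : (0 < q)%N -> (b 0 < l (lshift q i))%N.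
  by move=> q0; rewrite /b subn1; exact: mu_large (ltn_ord i) q0.
have lq i : (q <= l (lshift q i))%N by rewrite /l /=; have := ltn_ord i; lia.
have ln i : (l i <= n)%N.
  have [i' ->|i' ->] := split_ordP i; first exact: mu_n (ltn_ord i').
  by rewrite lr (leq_trans _ wn) // leq_nth_sumn.
have s_pos : all (fun a => 0 < a <= n)%N s.
  apply/(all_nthP 0%N) => j js; rewrite nth_s //.
  have vj : (nth 0%N v j < q)%N by apply: (allP vq); rewrite mem_nth // -szs.
  have := b_large _ js; have := leq_nth_sumn w (q - j.+1); rewrite -/(b j); lia.
pose E := elemgen (fun i : 'I_k => 'X_i : {mpoly rat[k]}).
have hneg := @hx_Negz n k; have hE := @elemgen_hx n k.
have E0 : E`_0 = 1 := coef0_elemgen _.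
have sE : (size E <= k.+1)%N := size_elemgen _.
have lsn t i : ((l i)%:Z - (@shift _ s t i)%:Z <= n%:Z)%R by have := ln i; lia.
rewrite /dprod -/s (schurE n szmu) dt_foldr_shdet // /evalx rmorph_sum /=.
(* The surviving term: counting from 0, row [k + j] carries w_{q-j} and is lowered by a_{j+1}. *)
pose t0 : (size s).-tuple 'I_(k + q) := [tuple rshift k (widen_ord sq j) | j < size s].
rewrite (bigD1 t0) //= big1 ?addr0 => [|t tt0]; last first.
  (* Either all values below [q] occur, and uniqueness forces [t = t0], or a missing value kills the
     determinant. *)
  have [/'forall_existsP f_onto|] :=
    boolP [forall u : 'I_q, exists i, (l i)%:Z - (shift t i)%:Z == u%:Z].
    have ut := unique_shift sq (esym szs) v_sorted vq nth_s b_decr b_large b_small bv lr ll lq.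
    case/eqP: tt0; apply: eq_from_tnth => j; rewrite tnth_mktuple; apply: val_inj.
    rewrite /= ut // => u uq; have [i /eqP fi] := f_onto (Ordinal uq).
    by exists i.
  rewrite negb_forall => /existsP[u]; rewrite negb_exists => /forallP nu.
  have := evalx_shdet n k (fun i => (l i)%:Z - (shift t i)%:Z); rewrite /evalx => ->.
  by apply: (det_shiftmx_eq0 hneg hE E0 sE (v := u)) => //; rewrite addKn.
have := evalx_shdet n k (fun i => (l i)%:Z - (shift t0 i)%:Z); rewrite /evalx => ->.
have t0_uniq : uniq t0.
  by apply/tuple_uniqP => i j; rewrite !tnth_mktuple => /rshift_inj [] /val_inj.
have sh_l i : shift t0 (lshift q i) = 0%N.
  rewrite shift_notin //; apply/negP => /tnthP[j]; rewrite tnth_mktuple => /eqP.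
  by rewrite eq_lrshift.
have sh_r i : shift t0 (rshift k i) = nth 0%N s i.
  have [si|si] := ltnP i (size s).
    have -> : rshift k i = tnth t0 (Ordinal si).
      by rewrite tnth_mktuple; congr rshift; apply: val_inj.
    by rewrite shift_tnth.
  rewrite nth_default // shift_notin //; apply/negP => /tnthP[j].
  by rewrite tnth_mktuple => /rshift_inj e; move: si; rewrite e /= leqNgt ltn_ord.
rewrite (det_shiftmx_block hneg hE E0 sE) //; last first.
  by move=> i; rewrite sh_l subr0 lez_nat.
pose c (i : 'I_q) := nth 0%N (cseq w (k + q) k) i.
have szc : size (cseq w (k + q) k) = q.
  by rewrite size_cat !size_map !size_iota mkE addKn -szs subnKC.
(* Past [size s] the default 0 of [nth] expresses that the row is not lowered. *)
have cE (i : 'I_q) : c i = (b i - nth 0%N s i)%N.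
  have iq := ltn_ord i; rewrite /c nth_cat size_map size_iota mkE -szs.
  have [si|si] := ltnP i (size s).
    rewrite (nth_map 0%N) ?size_iota -?szs // nth_iota -?szs // add1n wsE // nth_s //.
    have := b_large _ si; have := allP vq _ (mem_nth 0%N (leq_trans si (eq_leq szs))).
    by rewrite -/v /=; lia.
  rewrite (nth_map 0%N) ?size_iota addKn ?nth_iota; try lia.
  by rewrite (nth_default 0%N si) subn0 /b /wg; congr nth; lia.
have c_small (i : 'I_q) : (size s <= i)%N -> c i = b i.
  by move=> si; rewrite cE nth_default // subn0.
have c_large (i : 'I_q) : (i < size s)%N -> c i = nth 0%N v i.
  move=> si; rewrite cE nth_s //.
  have := b_large _ si; have := allP vq _ (mem_nth 0%N (leq_trans si (eq_leq szs))).
  by rewrite /=; lia.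
have cq i : (c i < q)%N.
  have [si|si] := ltnP i (size s); last by rewrite c_small // b_small // si ltn_ord.
  by rewrite c_large //; apply: (allP vq); rewrite mem_nth // -szs.
(* Membership in [v] separates lowered from unlowered rows; injectivity is then checked within each
   kind. *)
have cv' (i : 'I_q) : (c i \in v) = (i < size s)%N.
  have [si|si] := ltnP i (size s); first by rewrite c_large // mem_nth // -szs.
  by rewrite c_small //; apply/negbTE/bv.
have cI : injective c.
  move=> i j eij; apply: val_inj; have := cv' i; rewrite eij cv' => eij'.
  move: eij; have [si|si] := ltnP i (size s).
    have sj : (j < size s)%N by rewrite eij'.
    rewrite !c_large // => /eqP; rewrite nth_uniq ?filter_uniq ?iota_uniq -?szs //.
    by move/eqP.
  have sj : (size s <= j)%N by rewrite leqNgt eij' -leqNgt.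
  rewrite !c_small // => e; case: (ltngtP i j) => // ij.
    by have := @b_decr i j; rewrite ij ltn_ord e ltnn => /(_ isT).
  by have := @b_decr j i; rewrite ij ltn_ord e ltnn => /(_ isT).
have -> : \det (revmx {mpoly rat[k]} (fun i => (l (rshift k i))%:Z - (shift t0 (rshift k i))%:Z))
  = \det (revmx {mpoly rat[k]} (fun i => (c i)%:Z)).
  congr (\det _); apply/matrixP=> i j; rewrite !mxE lr sh_r cE subzn //.
  have [si|si] := ltnP i (size s); last by rewrite nth_default.
  by rewrite nth_s // leq_subr.
(* The lower block gives the sign [ck], the upper one the Schur determinant of the first [k]
   parts. *)
rewrite (det_revmx _ cI cq) mulrC /ck (sign_to_decrE szc) -mul_mpolyC rmorphXn rmorphN1.
congr (_ * _); rewrite (@schurE n (take k mu) k); last first.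
  by rewrite size_take szmu; case: ltnP; lia.
rewrite -/(evalx k _) evalx_shdet; congr (\det _); apply/matrixP=> i j.
rewrite !mxE sh_l /l nth_take //=; congr (hx _ _ _).
by have := ltn_ord i; lia.
Qed.

(** Over d places a strictly increasing list grows by at least d, so w_i - i is weakly
    increasing. *)
Lemma nth_lam_ge (w : seq nat) i j : sorted ltn w -> (i <= j < size w)%N ->
  (nth 0%N (lam w) j <= nth 0%N (lam w) i)%N.
Proof.
move=> ws ij; rewrite !nth_lam; [|lia..].
have := @sorted_ltn_nthD w (size w - j.+1) (j - i) ws.
have -> : (size w - j.+1 + (j - i) = size w - i.+1)%N by lia.
lia.
Qed.

(** The lower bounds on [n] ensure that t_1, ..., t_n include every variable of the Schur
    polynomials and every direction of differentiation. *)
Theorem theorem2p1 (g : nat) (w : seq nat) (k : nat) :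
  gap_seq g w -> (k <= g)%N ->
  (forall n : nat, (sumn w + g <= n)%N ->
     evalx k (dprod w g k (schur n (lam w)))
     = ck w g k *: evalx k (schur n (take k (lam w))))
  /\
  (forall (mu : seq nat) (n : nat),
     size mu = g -> sorted geq mu -> drop k mu = drop k (lam w) ->
     (sumn mu + sumn w + g <= n)%N ->
     evalx k (dprod w g k (schur n mu))
     = ck w g k *: evalx k (schur n (take k mu))).
Proof.
case=> _ szw ws _ _ /subnKC; set q := (g - k)%N => gE; rewrite -gE in szw *.
have nth_w i : (i < k + q)%N ->
    (nth 0%N (lam w) i + (k + q - i.+1))%N = nth 0%N w (k + q - i.+1).
  by move=> ik; rewrite -szw nth_lamD // szw.
(* Row [k] carries w_q; an earlier row has at least as large a part and a strictly larger staircase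
   term. *)
have large (mu : seq nat) i :
    (forall j, (k <= j < k + q)%N -> nth 0%N mu j = nth 0%N (lam w) j) ->
    (0 < q)%N -> (i < k)%N -> (nth 0%N mu k <= nth 0%N mu i)%N ->
    (nth 0%N w q.-1 < nth 0%N mu i + (k + q - i.+1))%N.
  move=> e q0 ik le; have := nth_w k; rewrite -e; last by lia.
  by have -> : (k + q - k.+1 = q.-1)%N; lia.
split=> [n wn|mu n szmu mu_sorted mu_drop mun].
  apply: evalx_dprod_schur => //; first by rewrite size_map size_iota.
  - by move=> i ik q0; apply: large => //; apply: nth_lam_ge => //; lia.
  - by move=> i ik; rewrite nth_w; have := leq_nth_sumn w (k + q - i.+1); lia.
  - lia.
have mu_lam j : (k <= j < k + q)%N -> nth 0%N mu j = nth 0%N (lam w) j.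
  by case/andP=> kj _; rewrite -(subnKC kj) -!nth_drop mu_drop.
apply: evalx_dprod_schur => //; last by lia.
- move=> i ik q0; apply: large => //.
  have geq_trans : transitive geq by move=> x y z /= yx xz; apply: leq_trans xz yx.
  by apply: (sorted_leq_nth geq_trans leqnn 0%N mu_sorted); rewrite ?inE ?szmu; lia.
- by move=> i ik; have := leq_nth_sumn mu i; lia.
Qed.
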